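(* Superclub at $\omega_1$ (i.e. $\clubsuit^{\Diamond}_{\omega_1}$) implies $\mathfrak{s}=\omega_1$.
   Context: $\clubsuit^{\Diamond}_{\omega_1}$ is the existence of a sequence $(S_\alpha\mid\alpha<\omega_1)$ with $S_\alpha\subseteq\alpha$ such that for every $A\in[\omega_1]^{\omega_1}$ there is $B\in[A]^{\omega_1}$ for which $\{\alpha<\omega_1\mid B\cap\alpha=S_\alpha\}$ is stationary in $\omega_1$. For an infinite cardinal $\kappa$ and $B,S\in[\kappa]^\kappa$, $S$ splits $B$ iff $|B\cap S|=|B\setminus S|=\kappa$; a family $\mathcal{F}\subseteq[\kappa]^\kappa$ is splitting iff every $B\in[\kappa]^\kappa$ is split by some member of $\mathcal{F}$; $\mathfrak{s}_\kappa$ is the minimal cardinality of a splitting family, and $\mathfrak{s}=\mathfrak{s}_{\aleph_0}$. *)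

(* Defs.v *)
Definition injective {X Y : Type} (f : X -> Y) : Prop :=
  forall x y, f x = f y -> x = y.
Definition surjective {X Y : Type} (f : X -> Y) : Prop :=
  forall y, exists x, f x = y.
Definition equipotent (X Y : Type) : Prop :=
  exists f : X -> Y, injective f /\ surjective f.
Definition card_le (X Y : Type) : Prop :=
  exists f : X -> Y, injective f.

Record is_omega1 (W : Type) (lt : W -> W -> Prop) : Prop := {
  om1_irrefl : forall x, ~ lt x x;
  om1_trans : forall x y z, lt x y -> lt y z -> lt x z;
  om1_total : forall x y, lt x y \/ x = y \/ lt y x;
  om1_wf : well_founded lt;
  om1_uncountable : ~ card_le W nat;
  om1_segments_countable : forall a, card_le {x : W | lt x a} nat
}.

Definition unbounded {W} (lt : W -> W -> Prop) (C : W -> Prop) : Prop :=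
  forall x, exists y, lt x y /\ C y.
(** closed: every nonzero alpha such that C is unbounded below alpha
    (this forces alpha to be a limit) belongs to C. *)
Definition closed {W} (lt : W -> W -> Prop) (C : W -> Prop) : Prop :=
  forall a, (exists b, lt b a) ->
    (forall b, lt b a -> exists g, lt b g /\ lt g a /\ C g) -> C a.
Definition club {W} (lt : W -> W -> Prop) (C : W -> Prop) : Prop :=
  closed lt C /\ unbounded lt C.
Definition stationary {W} (lt : W -> W -> Prop) (T : W -> Prop) : Prop :=
  forall C, club lt C -> exists a, C a /\ T a.

Definition clubsuit_diamond (W : Type) (lt : W -> W -> Prop) : Prop :=
  exists S : W -> W -> Prop,
    (forall a b, S a b -> lt b a) /\
    forall A : W -> Prop, equipotent {x : W | A x} W ->
      exists B : W -> Prop,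
        (forall x, B x -> A x) /\ equipotent {x : W | B x} W /\
        stationary lt (fun a => forall b, (B b /\ lt b a) <-> S a b).

Definition size_omega (X : nat -> Prop) : Prop := equipotent {n : nat | X n} nat.
Definition splits (S B : nat -> Prop) : Prop :=
  size_omega (fun n => B n /\ S n) /\ size_omega (fun n => B n /\ ~ S n).
Definition splitting_family (F : (nat -> Prop) -> Prop) : Prop :=
  (forall S, F S -> size_omega S) /\
  forall B, size_omega B -> exists S, F S /\ splits S B.

(** s = omega_1 (with (W,lt) a copy of omega_1): the minimum size of a splitting
    family is aleph_1, i.e. some splitting family has size aleph_1 and every
    splitting family has size >= aleph_1. *)
Definition s_eq_omega1 (W : Type) : Prop :=
  (exists F, splitting_family F /\ equipotent {S : nat -> Prop | F S} W) /\
  (forall F, splitting_family F -> card_le W {S : nat -> Prop | F S}).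

(* Main.v *)
(** The splitting family is [{c a | a < omega_1}], where [c a] is chosen by
    recursion so as to split every infinite set of the form
    [T b i = {n | all g in S b have c g n = i}] with [b < a] and [i < 2].
    If it failed to split some infinite [D], then for uncountably many [a] the
    set [c a] would have the same constant value [i] on the same cofinite part
    of [D]; superclub yields an uncountable set [B] of such [a] with
    [S b] equal to [B] cut at [b] for stationarily many [b].  The sets
    [{n | all g < b in B have c g n = i}] decrease with [b], hence stabilise at
    [T = {n | all g in B have c g n = i}], so [T b i = T] for a suitable [b].
    Any [a] in [B] above [b] must split [T], whereas [c a] is constant on [T]. *)

Require Import Defs.
From Stdlib Require Import Classical ClassicalEpsilon FunctionalExtensionality.
From Stdlib Require Import Arith Cantor List FinFun Lia.

(** * Well-founded recursion with choice *)

(** [P] takes a total [g], which keeps dependent types out of its uses. The second hypothesis makes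
    [P x g z] depend on [g] only below [x], so any padding elsewhere, here by the default [d], is
    harmless. *)
Lemma wf_recursive_choice (W X : Type) (lt : W -> W -> Prop) (d : X)
    (P : W -> (W -> X) -> X -> Prop) :
  well_founded lt ->
  (forall x g g' z, (forall y, lt y x -> g y = g' y) -> P x g z -> P x g' z) ->
  (forall x g, exists z, P x g z) ->
  exists f : W -> X, forall x, P x f (f x).
Proof.
  intros wf ext ex.
  pose (below := fun x (g : forall y, lt y x -> X) y =>
    match excluded_middle_informative (lt y x) with
    | left h => g y h | right _ => d end).
  pose (step := fun x g =>
    proj1_sig (constructive_indefinite_description _ (ex x (below x g)))).
  pose (f := Fix wf (fun _ => X) step).
  exists f; intro x.
  assert (fE : f x = step x (fun y _ => f y)).
  { apply (Fix_eq wf (fun _ => X) step); intros y g g' gg'.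
    replace g' with g; [reflexivity|].
    extensionality z; extensionality h; apply gg'. }
  rewrite fE; unfold step.
  destruct (constructive_indefinite_description _ _) as [z Pz]; simpl.
  refine (ext _ _ _ _ _ Pz); intros y yx; unfold below.
  destruct (excluded_middle_informative _); tauto.
Qed.

Lemma wf_minimal (W : Type) (lt : W -> W -> Prop) (P : W -> Prop) :
  well_founded lt -> (exists x, P x) ->
  exists x, P x /\ forall y, P y -> ~ lt y x.
Proof.
  intros wf [x Px]; revert Px; induction x as [x IH] using (well_founded_ind wf).
  intro Px; destruct (classic (exists y, P y /\ lt y x)) as [[y [Py yx]]|no].
  - exact (IH y yx Py).
  - exists x; split; [exact Px|]; intros y Py yx; eauto.
Qed.

(** * Equipotence and enumeration of subsets *)

Lemma sig_eq (X : Type) (P : X -> Prop) (u v : {x | P x}) :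
  proj1_sig u = proj1_sig v -> u = v.
Proof.
  destruct u as [x p], v as [y q]; simpl; intros <-.
  now rewrite (proof_irrelevance _ p q).
Qed.

Lemma equipotent_sym (X Y : Type) : equipotent X Y -> equipotent Y X.
Proof.
  intros [f [inj sur]].
  destruct (choice (fun y x => f x = y) sur) as [g fg].
  exists g; split.
  - intros y y' e; rewrite <- (fg y), <- (fg y'), e; reflexivity.
  - intro x; exists (f x); apply inj, fg.
Qed.

Lemma equipotent_trans (X Y Z : Type) :
  equipotent X Y -> equipotent Y Z -> equipotent X Z.
Proof.
  intros [f [fi fs]] [g [gi gs]]; exists (fun x => g (f x)); split.
  - intros x y e; apply fi, gi, e.
  - intro z; destruct (gs z) as [y <-]; destruct (fs y) as [x <-]; now exists x.
Qed.

(* The increasing enumeration of a subset of a well-ordered type by another one;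
   the two cardinality conditions say that neither side runs out early. *)
Lemma equipotent_enumeration (W V : Type) (ltW : W -> W -> Prop)
    (ltV : V -> V -> Prop) (A : V -> Prop) :
  well_founded ltW -> (forall x y, ltW x y \/ x = y \/ ltW y x) ->
  well_founded ltV -> (forall x y, ltV x y \/ x = y \/ ltV y x) ->
  inhabited V ->
  (forall x (g : W -> V), exists a, A a /\ forall y, ltW y x -> g y <> a) ->
  (forall a (g : W -> V), injective g -> ~ forall x, ltV (g x) a) ->
  equipotent {v | A v} W.
Proof.
  intros wfW totW wfV totV [d] long short; apply equipotent_sym.
  destruct (wf_recursive_choice W V ltW d
    (fun x g z => (A z /\ forall y, ltW y x -> g y <> z) /\
       forall z', (A z' /\ forall y, ltW y x -> g y <> z') -> ~ ltV z' z))
    as [f Hf].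
  - exact wfW.
  - intros x g g' z e [[Az gz] m]; split; [split|].
    + exact Az.
    + intros y yx; rewrite <- (e y yx); auto.
    + intros z' [Az' gz']; apply m; split; [exact Az'|].
      intros y yx; rewrite (e y yx); auto.
  - intros x g; exact (wf_minimal V ltV _ wfV (long x g)).
  - assert (fA : forall x, A (f x)) by (intro x; apply Hf).
    assert (finj : injective f).
    { intros x y e; destruct (totW x y) as [l|[l|l]]; [|exact l|]; exfalso.
      - exact (proj2 (proj1 (Hf y)) x l e).
      - exact (proj2 (proj1 (Hf x)) y l (eq_sym e)). }
    exists (fun x => exist _ (f x) (fA x)); split.
    + intros x y e; apply finj; now injection e.
    (* A missed [a] stays a candidate at every stage, so by minimality each [f x] lies below [a],
       against [short]. *)
    + intros [a Aa]; destruct (classic (exists x, f x = a)) as [[x e]|no].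
      * exists x; now apply sig_eq.
      * exfalso; apply (short a f finj); intro x.
        assert (m : ~ ltV a (f x)).
        { apply (Hf x); split; [exact Aa|]; intros y _ e; eauto. }
        destruct (totV (f x) a) as [l|[l|l]]; [exact l| |tauto].
        exfalso; eauto.
Qed.

(** * Infinite sets of natural numbers *)

Definition infinite (X : nat -> Prop) : Prop := forall m, exists n, m <= n /\ X n.

Lemma nat_no_bounded_injection (f : nat -> nat) (m : nat) :
  injective f -> ~ forall n, f n < m.
Proof.
  intros inj bd.
  assert (le : length (map f (seq 0 (S m))) <= length (seq 0 m)).
  { apply NoDup_incl_length.
    - apply Injective_map_NoDup; [exact inj|apply seq_NoDup].
    - intros k kin; apply in_map_iff in kin; destruct kin as [n [<- _]].
      apply in_seq; specialize (bd n); lia. }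
  rewrite length_map, !length_seq in le; lia.
Qed.

Lemma nat_initial_bound (g : nat -> nat) (x : nat) :
  exists m, forall y, y < x -> g y < m.
Proof.
  induction x as [|x [m IH]].
  - exists 0; lia.
  - exists (S (m + g x)); intros y yx.
    destruct (Nat.eq_dec y x) as [->|ne]; [lia|].
    specialize (IH y); lia.
Qed.

Lemma size_omega_infinite (X : nat -> Prop) : size_omega X <-> infinite X.
Proof.
  split.
  - intros eq m; apply NNPP; intro no.
    destruct (equipotent_sym _ _ eq) as [f [inj _]].
    apply (nat_no_bounded_injection (fun n => proj1_sig (f n)) m).
    + intros n n' e; apply inj, sig_eq, e.
    + intro n; destruct (f n) as [k Xk]; simpl.
      destruct (Nat.lt_ge_cases k m); [assumption|exfalso; eauto].
  - intro inf; apply (equipotent_enumeration nat nat Nat.lt Nat.lt).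
    1, 3: exact Nat.lt_wf_0.
    1, 2: intros x y; unfold Nat.lt; lia.
    + exact (inhabits 0).
    + intros x g; destruct (nat_initial_bound g x) as [m gm].
      destruct (inf m) as [n [mn Xn]]; exists n; split; [exact Xn|].
      intros y yx; specialize (gm y yx); lia.
    + intros a g; apply nat_no_bounded_injection.
Qed.

Lemma splits_infinite (S B : nat -> Prop) :
  splits S B <->
  infinite (fun n => B n /\ S n) /\ infinite (fun n => B n /\ ~ S n).
Proof. unfold splits; now rewrite !size_omega_infinite. Qed.

Lemma infinite_incl (X Y : nat -> Prop) :
  (forall n, X n -> Y n) -> infinite X -> infinite Y.
Proof. intros XY inf m; destruct (inf m) as [n [mn Xn]]; eauto. Qed.

Lemma not_infinite_bounded (X : nat -> Prop) :
  ~ infinite X -> exists m, forall n, m <= n -> ~ X n.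
Proof.
  intro ninf; apply not_all_ex_not in ninf; destruct ninf as [m Hm].
  exists m; intros n mn Xn; eauto.
Qed.

(** Serves both to visit countably many infinite sets infinitely often and to diagonalise through a
    decreasing sequence. *)
Lemma increasing_choice (Y : nat -> nat -> Prop) :
  (forall k, infinite (Y k)) ->
  exists a : nat -> nat,
    (forall n, Y n (a n)) /\ forall m n, m < n -> a m < a n.
Proof.
  intro inf.
  destruct (wf_recursive_choice nat nat Nat.lt 0
    (fun n g z => Y n z /\ forall m, m < n -> g m < z)) as [a Ha].
  - exact Nat.lt_wf_0.
  - intros x g g' z e [Yz gz]; split; [exact Yz|].
    intros m mx; rewrite <- (e m mx); auto.
  - intros x g; destruct (nat_initial_bound g x) as [m gm].
    destruct (inf x m) as [n [mn Yn]]; exists n; split; [exact Yn|].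
    intros y yx; specialize (gm y yx); lia.
  - exists a; split; [apply Ha|]; intros m n mn; now apply (Ha n).
Qed.

Lemma increasing_ge (a : nat -> nat) :
  (forall m n, m < n -> a m < a n) -> forall n, n <= a n.
Proof.
  intros inc n; induction n as [|n IH]; [lia|].
  specialize (inc n (S n)); lia.
Qed.

(* [a] visits each [Y k] infinitely often at even and infinitely often at odd
   second Cantor coordinate; the even visits form the splitting set. *)
Lemma split_sequence (Y : nat -> nat -> Prop) :
  (forall k, infinite (Y k)) -> exists X, forall k, splits X (Y k).
Proof.
  intro inf.
  destruct (increasing_choice (fun n => Y (fst (of_nat n)))) as [a [aY inc]].
  { intro n; apply inf. }
  assert (ge := increasing_ge a inc).
  assert (visit : forall k j, Y k (a (to_nat (k, j))) /\ j <= a (to_nat (k, j))).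
  { intros k j; split.
    - specialize (aY (to_nat (k, j))); now rewrite cancel_of_to in aY.
    - specialize (ge (to_nat (k, j))).
      pose proof (to_nat_non_decreasing k j); lia. }
  exists (fun z => exists k j, z = a (to_nat (k, 2 * j))).
  intro k; apply splits_infinite; split; intro m.
  - exists (a (to_nat (k, 2 * m))); destruct (visit k (2 * m)).
    repeat split; [lia|assumption|eauto].
  - exists (a (to_nat (k, 2 * m + 1))); destruct (visit k (2 * m + 1)).
    repeat split; [lia|assumption|].
    intros [k' [j e]].
    assert (e' : to_nat (k, 2 * m + 1) = to_nat (k', 2 * j)).
    { destruct (Nat.lt_trichotomy (to_nat (k, 2 * m + 1)) (to_nat (k', 2 * j)))
        as [l|[l|l]]; [apply inc in l; lia|exact l|apply inc in l; lia]. }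
    apply to_nat_inj in e'; injection e'; lia.
Qed.

Lemma split_countable_family (J : Type) (Y : J -> nat -> Prop) :
  card_le J nat -> (forall j, infinite (Y j)) ->
  exists X, size_omega X /\ forall j, splits X (Y j).
Proof.
  intros [g ginj] inf.
  (* Index 0 holds all of [nat], so that splitting it makes [X] itself infinite. Index [S k] holds
     the [Y j] with [g j = k], and again all of [nat] if [k] is not a value of [g]. *)
  destruct (split_sequence
    (fun k n => match k with 0 => True | S k => forall j, g j = k -> Y j n end))
    as [X HX].
  - intros [|k].
    + intro m; exists m; auto.
    + destruct (classic (exists j, g j = k)) as [[j <-]|no].
      * apply (infinite_incl (Y j)); [|apply inf].
        intros n Yn j' e; apply ginj in e; now subst.
      * intro m; exists m; split; [lia|]; intros j e; exfalso; eauto.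
  - exists X; split.
    + apply size_omega_infinite.
      destruct (proj1 (splits_infinite _ _) (HX 0)) as [i _].
      revert i; apply infinite_incl; tauto.
    + intro j; apply splits_infinite.
      destruct (proj1 (splits_infinite _ _) (HX (S (g j)))) as [i i'].
      split; [revert i|revert i']; apply infinite_incl; firstorder.
Qed.

(** * Countable families do not split *)

Lemma infinite_partition (B S : nat -> Prop) :
  infinite B ->
  infinite (fun n => B n /\ S n) \/ infinite (fun n => B n /\ ~ S n).
Proof.
  intro inf; apply NNPP; intro no; apply not_or_and in no; destruct no as [n1 n2].
  apply not_infinite_bounded in n1, n2.
  destruct n1 as [m1 H1], n2 as [m2 H2].
  destruct (inf (m1 + m2)) as [n [mn Bn]].
  destruct (classic (S n)); [apply (H1 n)|apply (H2 n)]; auto; lia.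
Qed.

(** [B] is a pseudo-intersection of decreasing infinite sets [D k], where [D (S k)] lies on one side
    of [E k]. Almost all of [B] is then on that side. *)
Lemma unsplit_by_sequence (E : nat -> nat -> Prop) :
  exists B, infinite B /\ forall k, ~ splits (E k) B.
Proof.
  (* The equivalence selects the points inside [S] if they are infinitely many, and those outside
     [S] otherwise. *)
  pose (part := fun (B S : nat -> Prop) n =>
    B n /\ (S n <-> infinite (fun n => B n /\ S n))).
  pose (D := fix D k := match k with
    0 => fun _ => True | S k => part (D k) (E k) end).
  assert (Dinf : forall k, infinite (D k)).
  { induction k as [|k IH]; simpl.
    - intro m; exists m; auto.
    - destruct (classic (infinite (fun n => D k n /\ E k n))) as [i|i].
      + apply (infinite_incl _ _ (fun n H => conj (proj1 H)
          (conj (fun _ => i) (fun _ => proj2 H))) i).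
      + destruct (infinite_partition (D k) (E k) IH) as [i'|i']; [tauto|].
        revert i'; apply infinite_incl; unfold part; tauto. }
  assert (Dmono : forall j k, j <= k -> forall n, D k n -> D j n).
  { intros j k jk; induction jk as [|k jk IH]; [auto|].
    intros n [Dn _]; auto. }
  destruct (increasing_choice D Dinf) as [a [aD inc]].
  exists (fun z => exists n, z = a n); split.
  - intro m; exists (a m); split; [now apply increasing_ge|eauto].
  - intros k sp; apply splits_infinite in sp; destruct sp as [i i'].
    (* Points of [B] from [a (S k)] on have index at least [S k], hence lie in [D (S k)]. *)
    destruct (i (a (S k))) as [z [zk [[n ->] En]]].
    destruct (i' (a (S k))) as [z' [zk' [[n' ->] En']]].
    assert (H : forall n, a (S k) <= a n -> D (S k) (a n)).
    { intros p le; apply (Dmono (S k) p); [|apply aD].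
      destruct (Nat.lt_ge_cases p (S k)) as [l|l]; [apply inc in l; lia|exact l]. }
    pose proof (proj2 (H n zk)) as P; pose proof (proj2 (H n' zk')) as P'.
    cbv beta in P, P'; tauto.
Qed.

Lemma splitting_family_uncountable (F : (nat -> Prop) -> Prop) :
  splitting_family F -> ~ card_le {S | F S} nat.
Proof.
  intros [_ spl] [g ginj].
  (* The family is listed along its injection [g] into [nat]; numbers that are not values of [g]
     list the empty set. *)
  destruct (unsplit_by_sequence
    (fun k n => exists u : {S | F S}, g u = k /\ proj1_sig u n)) as [B [inf no]].
  destruct (spl B) as [S [FS sp]]; [now apply size_omega_infinite|].
  apply (no (g (exist _ S FS))); apply splits_infinite.
  apply splits_infinite in sp; destruct sp as [i i'].
  split; [revert i|revert i']; apply infinite_incl; intros n [Bn Sn];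
    (split; [exact Bn|]).
  - now exists (exist _ S FS).
  - intros [u [e un]]; apply ginj in e; now subst.
Qed.

(** * Countable subsets of omega_1 *)

Definition countable_subset {W : Type} (P : W -> Prop) : Prop :=
  exists h : W -> nat, forall x y, P x -> P y -> h x = h y -> x = y.

Lemma countable_subset_sig (W : Type) (P : W -> Prop) :
  countable_subset P <-> card_le {x | P x} nat.
Proof.
  split.
  - intros [h inj]; exists (fun u => h (proj1_sig u)).
    intros [x Px] [y Py] e; apply sig_eq; now apply inj.
  - intros [g inj].
    exists (fun x => match excluded_middle_informative (P x) with
      | left p => g (exist _ x p) | right _ => 0 end).
    intros x y Px Py.
    destruct (excluded_middle_informative (P x)); [|tauto].
    destruct (excluded_middle_informative (P y)); [|tauto].
    intro e; apply inj in e; now injection e.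
Qed.

Lemma countable_union (W : Type) (U : nat -> W -> Prop) :
  (forall k, countable_subset (U k)) -> (forall x, exists k, U k x) ->
  card_le W nat.
Proof.
  intros cU cov.
  destruct (choice _ cU) as [h inj]; destruct (choice _ cov) as [k Uk].
  exists (fun x => to_nat (k x, h (k x) x)); intros x y e.
  apply to_nat_inj in e; injection e as e1 e2.
  rewrite <- e1 in e2; apply (inj (k x)); [apply Uk|rewrite e1; apply Uk|exact e2].
Qed.

Section Omega1.

Variables (W : Type) (lt : W -> W -> Prop).
Hypothesis om1 : is_omega1 W lt.

Lemma countable_initial_segment (a : W) :
  countable_subset (fun x => lt x a \/ x = a).
Proof.
  destruct (proj2 (countable_subset_sig _ _) (om1_segments_countable _ _ om1 a))
    as [h inj].
  exists (fun x => if excluded_middle_informative (x = a) then 0 else S (h x)).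
  intros x y Px Py.
  destruct (excluded_middle_informative (x = a)),
    (excluded_middle_informative (y = a)); try congruence; intro e.
  injection e; apply inj; tauto.
Qed.

(** Without a bound, the countable segments up to the [s n] would cover [W]. *)
Lemma omega1_sequence_bounded (s : nat -> W) : exists b, forall n, lt (s n) b.
Proof.
  apply NNPP; intro no; apply (om1_uncountable _ _ om1).
  apply (countable_union W (fun n x => lt x (s n) \/ x = s n)).
  - intro n; apply countable_initial_segment.
  - intro x; apply NNPP; intro nx; apply no; exists x; intro n.
    destruct (om1_total _ _ om1 x (s n)) as [l|[l|l]]; [| |exact l];
      exfalso; eauto.
Qed.

Lemma omega1_above (x y : W) : exists b, lt x b /\ lt y b.
Proof.
  destruct (omega1_sequence_bounded (fun n => match n with 0 => x | _ => y end))
    as [b Hb].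
  exists b; split; [exact (Hb 0)|exact (Hb 1)].
Qed.

Lemma final_segment_club (a : W) : club lt (lt a).
Proof.
  split.
  - intros b [z zb] lim; destruct (lim z zb) as [g [_ [gb ag]]].
    exact (om1_trans _ _ om1 _ _ _ ag gb).
  - intro x; destruct (omega1_above x a) as [b Hb]; eauto.
Qed.

(** Always choose a value not taken before. If this were impossible at [x], the countably many
    values below [x] would exhaust [X]. *)
Lemma omega1_into_uncountable (X : Type) : ~ card_le X nat -> card_le W X.
Proof.
  intro unc.
  assert (d : inhabited X).
  { apply NNPP; intro no; apply unc; exists (fun _ => 0).
    intro x; exfalso; apply no; exact (inhabits x). }
  destruct d as [d].
  destruct (wf_recursive_choice W X lt d (fun x g z => forall y, lt y x -> g y <> z))
    as [f Hf].
  - exact (om1_wf _ _ om1).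
  - intros x g g' z e gz y yx; rewrite <- (e y yx); auto.
  - intros x g; apply NNPP; intro no; apply unc.
    destruct (om1_segments_countable _ _ om1 x) as [h hinj].
    assert (sur : forall z, exists u : {y | lt y x}, g (proj1_sig u) = z).
    { intro z; apply NNPP; intro nz; apply no; exists z; intros y yx e.
      apply nz; now exists (exist _ y yx). }
    destruct (choice _ sur) as [u gu].
    exists (fun z => h (u z)); intros z z' e; apply hinj in e.
    now rewrite <- (gu z), <- (gu z'), e.
  - exists f; intros x y e.
    destruct (om1_total _ _ om1 x y) as [l|[l|l]]; [|exact l|]; exfalso.
    + exact (Hf y x l e).
    + exact (Hf x y l (eq_sym e)).
Qed.

Lemma card_le_segment_uncountable (a : W) (g : W -> W) :
  injective g -> ~ forall x, lt (g x) a.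
Proof.
  intros inj bd; apply (om1_uncountable _ _ om1).
  destruct (om1_segments_countable _ _ om1 a) as [h hinj].
  exists (fun x => h (exist _ (g x) (bd x))); intros x y e.
  apply hinj in e; injection e; apply inj.
Qed.

Lemma uncountable_subset_equipotent (A : W -> Prop) :
  ~ countable_subset A -> equipotent {x | A x} W.
Proof.
  intro unc.
  assert (d : inhabited W).
  { apply NNPP; intro no; apply unc; exists (fun _ => 0).
    intro x; exfalso; apply no; exact (inhabits x). }
  apply (equipotent_enumeration W W lt lt); try exact d;
    try exact (om1_wf _ _ om1); try exact (om1_total _ _ om1).
  - intros x g; apply NNPP; intro no; apply unc, countable_subset_sig.
    destruct (om1_segments_countable _ _ om1 x) as [h hinj].
    assert (sur : forall v : {a | A a},
      exists u : {y | lt y x}, g (proj1_sig u) = proj1_sig v).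
    { intros [a Aa]; apply NNPP; intro nz; apply no; exists a.
      split; [exact Aa|]; intros y yx e.
      apply nz; now exists (exist _ y yx). }
    destruct (choice _ sur) as [u gu].
    exists (fun v => h (u v)); intros v v' e; apply hinj in e.
    apply sig_eq; now rewrite <- (gu v), <- (gu v'), e.
  - exact card_le_segment_uncountable.
Qed.

Lemma equipotent_unbounded (B : W -> Prop) :
  equipotent {x | B x} W -> forall a, exists b, B b /\ lt a b.
Proof.
  intros eq a; apply NNPP; intro no.
  destruct (equipotent_sym _ _ eq) as [f [inj _]].
  destruct (omega1_above a a) as [c [ac _]].
  apply (card_le_segment_uncountable c (fun x => proj1_sig (f x))).
  - intros x y e; apply inj, sig_eq, e.
  - intro x; destruct (f x) as [b Bb]; simpl.
    destruct (om1_total _ _ om1 a b) as [l|[<-|l]]; [exfalso; eauto|exact ac|].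
    exact (om1_trans _ _ om1 _ _ _ l ac).
Qed.

(** The map [c] need not be injective, so the image is identified with the set [A] of least
    preimages, an uncountable subset of [W]. *)
Lemma image_equipotent (X : Type) (c : W -> X) :
  ~ card_le {z | exists x, c x = z} nat -> equipotent {z | exists x, c x = z} W.
Proof.
  intro unc.
  pose (A := fun x => forall y, c y = c x -> ~ lt y x).
  assert (eq : equipotent {x | A x} {z | exists x, c x = z}).
  { exists (fun u => exist _ (c (proj1_sig u)) (ex_intro _ _ eq_refl)); split.
    - intros [x Ax] [y Ay] e; injection e as e; apply sig_eq; simpl in *.
      destruct (om1_total _ _ om1 x y) as [l|[l|l]]; [|exact l|]; exfalso.
      + exact (Ay x e l).
      + exact (Ax y (eq_sym e) l).
    - intros [z ex].
      destruct (wf_minimal W lt _ (om1_wf _ _ om1) ex) as [x [e m]].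
      assert (Ax : A x) by (intros y ey; apply m; congruence).
      exists (exist _ x Ax); now apply sig_eq. }
  apply (equipotent_trans _ _ _ (equipotent_sym _ _ eq)).
  apply uncountable_subset_equipotent; intro cA; apply unc.
  destruct (proj1 (countable_subset_sig _ _) cA) as [h hinj].
  destruct (equipotent_sym _ _ eq) as [g [ginj _]].
  exists (fun z => h (g z)); intros z z' e; apply ginj, hinj, e.
Qed.

(** * The splitting family obtained from superclub *)

(** For [S b] in place of [S] this is the set [T b i] of the overview; the colour [i = true] means
    membership in [c g], [false] non-membership. *)
Definition homogeneous_columns (c : W -> nat -> Prop) (S : W -> Prop) (i : bool)
    (n : nat) : Prop :=
  forall g, S g -> (c g n <-> i = true).

Lemma exists_diagonal_splitting (S : W -> W -> Prop) :
  (forall a b, S a b -> lt b a) ->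
  exists c : W -> nat -> Prop, forall a, size_omega (c a) /\
    forall b i, lt b a -> infinite (homogeneous_columns c (S b) i) ->
      splits (c a) (homogeneous_columns c (S b) i).
Proof.
  intro Slt.
  apply (wf_recursive_choice W (nat -> Prop) lt (fun _ => True)
    (fun a c X => size_omega X /\
      forall b i, lt b a -> infinite (homogeneous_columns c (S b) i) ->
        splits X (homogeneous_columns c (S b) i))).
  - exact (om1_wf _ _ om1).
  (* Since [S b] lies below [b] and [b] below [a], the sets to be split depend only on the values of
     [c] below [a]. *)
  - intros a c c' X e [inf spl]; split; [exact inf|]; intros b i ba.
    assert (eqc : forall n, homogeneous_columns c' (S b) i n <->
                            homogeneous_columns c (S b) i n).
    { intro n; split; intros H g Sg; specialize (H g Sg);
        rewrite e in * by exact (om1_trans _ _ om1 _ _ _ (Slt _ _ Sg) ba);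
        exact H. }
    intro i'; rewrite splits_infinite.
    assert (sp : splits X (homogeneous_columns c (S b) i)).
    { apply spl; [exact ba|]; revert i'; apply infinite_incl; firstorder. }
    apply splits_infinite in sp; destruct sp as [i1 i2].
    split; [revert i1|revert i2]; apply infinite_incl; firstorder.
  - intros a c.
    (* Below [a] there are only countably many pairs of a [b] and a colour. The implication replaces
       a finite [T] by all of [nat], so that every set listed is infinite. *)
    destruct (split_countable_family ({b | lt b a} * bool)
      (fun j n => let T := homogeneous_columns c (S (proj1_sig (fst j))) (snd j) in
         infinite T -> T n)) as [X [inf spl]].
    + destruct (om1_segments_countable _ _ om1 a) as [h hinj].
      exists (fun j => 2 * h (fst j) + Nat.b2n (snd j)).
      intros [u i] [v j]; simpl fst; simpl snd; intro e.
      assert (h u = h v /\ i = j) as [eu <-]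
        by (destruct i, j; simpl Nat.b2n in e; split; auto; lia).
      now rewrite (hinj _ _ eu).
    + intros [[b ba] i]; simpl.
      destruct (classic (infinite (homogeneous_columns c (S b) i))) as [y|n].
      * apply (infinite_incl _ _ (fun n H _ => H) y).
      * intro m; exists m; split; [lia|tauto].
    + exists X; split; [exact inf|]; intros b i ba iT.
      specialize (spl (exist _ b ba, i)); apply splits_infinite in spl.
      simpl in spl; apply splits_infinite.
      destruct spl as [i1 i2].
      split; [revert i1|revert i2]; apply infinite_incl; firstorder.
Qed.

Lemma diagonal_no_homogeneous_rectangle (S : W -> W -> Prop)
    (c : W -> nat -> Prop) (A : W -> Prop) (D : nat -> Prop) (i : bool) :
  (forall A : W -> Prop, equipotent {x : W | A x} W ->
      exists B : W -> Prop,
        (forall x, B x -> A x) /\ equipotent {x : W | B x} W /\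
        stationary lt (fun a => forall b, (B b /\ lt b a) <-> S a b)) ->
  (forall a b i, lt b a -> infinite (homogeneous_columns c (S b) i) ->
     splits (c a) (homogeneous_columns c (S b) i)) ->
  ~ countable_subset A -> infinite D ->
  ~ forall n, D n -> homogeneous_columns c A i n.
Proof.
  intros guess diag unc infD hom.
  destruct (guess A (uncountable_subset_equipotent A unc)) as [B [BA [eqB stat]]].
  destruct (classic (inhabited W)) as [[w]|empty].
  2: { apply unc; exists (fun _ => 0); intro x; exfalso; apply empty; now constructor. }
  (* Each [n] outside the homogeneous set of [B] is excluded by some [s n] in [B]. Once [b] is above
     all these countably many witnesses, [B] cut at [b] excludes the same numbers as [B]. *)
  assert (wit : forall n, exists s, ~ homogeneous_columns c B i n ->
    B s /\ ~ (c s n <-> i = true)).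
  { intro n; destruct (classic (homogeneous_columns c B i n)) as [y|no].
    - exists w; tauto.
    - apply not_all_ex_not in no; destruct no as [s Hs].
      exists s; intros _; apply imply_to_and, Hs. }
  destruct (choice _ wit) as [s Hs].
  destruct (omega1_sequence_bounded s) as [a0 Ha0].
  destruct (stat _ (final_segment_club a0)) as [b [a0b Sb]].
  destruct (equipotent_unbounded B eqB b) as [a [Ba ba]].
  assert (stable : forall n, homogeneous_columns c (S b) i n ->
    homogeneous_columns c B i n).
  { intros n H; apply NNPP; intro no; destruct (Hs n no) as [Bs ns].
    apply ns, H, Sb; split; [exact Bs|].
    exact (om1_trans _ _ om1 _ _ _ (Ha0 n) a0b). }
  assert (sp : splits (c a) (homogeneous_columns c (S b) i)).
  { apply diag; [exact ba|]; revert infD; apply infinite_incl.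
    intros n Dn g Sg; apply (hom n Dn), BA; now apply Sb in Sg. }
  apply splits_infinite in sp; destruct sp as [i1 i2].
  (* One point of the split set is in [c a] and another is not, yet [a] in [B] gives both the colour
     [i]. *)
  destruct (i1 0) as [n1 [_ [H1 c1]]], (i2 0) as [n2 [_ [H2 c2]]].
  pose proof (stable n1 H1 a Ba); pose proof (stable n2 H2 a Ba).
  destruct i; [tauto|]; assert (false = true) by tauto; discriminate.
Qed.

Lemma superclub_splitting_family :
  clubsuit_diamond W lt ->
  exists c : W -> nat -> Prop, splitting_family (fun S => exists a, c a = S).
Proof.
  intros [S [Slt guess]].
  destruct (exists_diagonal_splitting S Slt) as [c Hc].
  exists c; split; [intros X [a <-]; apply Hc|].
  intros D sD; apply size_omega_infinite in sD; apply NNPP; intro no.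
  (* The number [k] codes a threshold [Nat.div2 k] and, by its parity, the colour that [c a] takes
     on [D] from there on. *)
  pose (U := fun k a => forall n, D n /\ Nat.div2 k <= n ->
    (c a n <-> Nat.even k = true)).
  apply (om1_uncountable _ _ om1), (countable_union W U).
  - intro k; apply NNPP; intro unc.
    apply (diagonal_no_homogeneous_rectangle S c (U k)
      (fun n => D n /\ Nat.div2 k <= n) (Nat.even k) guess); auto.
    + intros a b i; apply Hc.
    + intro m; destruct (sD (m + Nat.div2 k)) as [n [mn Dn]].
      pose proof (Nat.le_add_r m (Nat.div2 k)); pose proof (Nat.le_add_l (Nat.div2 k) m).
      exists n; repeat split; eauto using Nat.le_trans.
    + intros n Dn a Ua; exact (Ua n Dn).
  - intro a; apply NNPP; intro na; apply no; exists (c a).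
    split; [eauto|]; apply splits_infinite.
    split; apply NNPP; intro fin; apply not_infinite_bounded in fin;
      destruct fin as [m Hm]; apply na.
    (* Beyond [m], [D] misses [c a]: an odd code, for the colour [false]. The other case takes the
       even code [2 * m]. *)
    + exists (Datatypes.S (2 * m)); intros n [Dn mn].
      rewrite Nat.div2_succ_double in mn.
      rewrite Nat.even_succ, Nat.odd_mul; simpl.
      split; [intro; exfalso; apply (Hm n mn); tauto|discriminate].
    + exists (2 * m); intros n [Dn mn].
      rewrite Nat.div2_double in mn.
      rewrite Nat.even_mul; simpl.
      split; [reflexivity|]; intros _; apply NNPP; intro; apply (Hm n mn); tauto.
Qed.

End Omega1.

Theorem theorem3p2 (W : Type) (lt : W -> W -> Prop) :
  is_omega1 W lt -> clubsuit_diamond W lt -> s_eq_omega1 W.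
Proof.
  intros om1 sc; split.
  - destruct (superclub_splitting_family W lt om1 sc) as [c spl].
    exists (fun S => exists a, c a = S); split; [exact spl|].
    apply (image_equipotent W lt om1), splitting_family_uncountable, spl.
  - intros F spl; apply (omega1_into_uncountable W lt om1).
    now apply splitting_family_uncountable.
Qed.
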